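(* For all finite sets of formulas $\Gamma,\Delta$: $\mathbf{D}^3_{\rm seq}\vdash\Gamma\Rightarrow_{\mathsf D}\Delta$ if and only if $\mathbf{D}^3_{\rm H}\vdash\bigwedge\Gamma\to\bigvee\Delta$.
   Context: Formulas are built from propositional variables and $\bot$ by $\to$ and $\Box$; other connectives are the usual classical abbreviations; the empty conjunction is $\top$ and the empty disjunction is $\bot$. $\Gamma,\Delta,\Pi,\Sigma,\ldots$ denote finite sets of formulas; commas denote union; $\Box\Gamma=\{\Box\gamma\mid\gamma\in\Gamma\}$. There are three kinds of sequents (tagged pairs of finite sets of formulas): GL-sequents $\Gamma\Rightarrow\Delta$, S-sequents $\Gamma\Rightarrow_{\mathsf S}\Delta$, D-sequents $\Gamma\Rightarrow_{\mathsf D}\Delta$. For each arrow $\blacktriangleright\in\{\Rightarrow,\Rightarrow_{\mathsf S},\Rightarrow_{\mathsf D}\}$, $\mathbf{LK}_{\blacktriangleright}$ has initial sequents $\varphi\blacktriangleright\varphi$ and $\bot\blacktriangleright\ $ (empty right side) and the rules: (weakening) from $\Gamma\blacktriangleright\Delta$ infer $\Gamma'\blacktriangleright\Delta'$, where $\Gamma\subseteq\Gamma'$, $\Delta\subseteq\Delta'$; ($\to$left) from $\Gamma\blacktriangleright\Delta,\varphi$ and $\psi,\Gamma\blacktriangleright\Delta$ infer $\varphi\to\psi,\Gamma\blacktriangleright\Delta$; ($\to$right) from $\varphi,\Gamma\blacktriangleright\Delta,\psi$ infer $\Gamma\blacktriangleright\Delta,\varphi\to\psi$; (cut) from $\Gamma\blacktriangleright\Delta,\varphi$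 and $\varphi,\Pi\blacktriangleright\Sigma$ infer $\Gamma,\Pi\blacktriangleright\Delta,\Sigma$. Further rules: (GL$\Box$) from $\Gamma,\Box\Gamma,\Box\varphi\Rightarrow\varphi$ infer $\Box\Gamma\Rightarrow\Box\varphi$; (GLtoS) from $\Gamma\Rightarrow\Delta$ infer $\Gamma\Rightarrow_{\mathsf S}\Delta$; (S$\Box$left) from $\varphi,\Gamma\Rightarrow_{\mathsf S}\Delta$ infer $\Box\varphi,\Gamma\Rightarrow_{\mathsf S}\Delta$; (StoD) from $\Box\Gamma\Rightarrow_{\mathsf S}\Box\Delta$ infer $\Box\Gamma\Rightarrow_{\mathsf D}\Box\Delta$. $\mathbf{D}^3_{\rm seq}$ consists of $\mathbf{LK}_{\Rightarrow}$, $\mathbf{LK}_{\Rightarrow_{\mathsf S}}$, $\mathbf{LK}_{\Rightarrow_{\mathsf D}}$, (GL$\Box$), (GLtoS), (S$\Box$left), (StoD). Hilbert systems. $\mathbf{GL}_{\rm H}$: axioms are all tautologies, $\Box(\varphi\to\psi)\to(\Box\varphi\to\Box\psi)$, $\Box(\Box\varphi\to\varphi)\to\Box\varphi$; rules are modus ponens and necessitation (from $\varphi$ infer $\Box\varphi$). $\mathbf{S}_{\rm H}$: axioms are all theorems of $\mathbf{GL}_{\rm H}$ and all $\Box\varphi\to\varphi$; the only rule is modus ponens. $\mathbf{D}^3_{\rm H}$: axioms are all tautologies and all formulas of the form $\bigwedge\Box\Gamma\to\bigvee\Box\Delta$ that are theorems of $\mathbf{S}_{\rm H}$; the only rule is modus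 ponens. *)

(* Defs.v *)
From HB Require Import structures.
From mathcomp Require Import all_boot finmap.

Set Implicit Arguments.
Unset Strict Implicit.
Unset Printing Implicit Defensive.

Local Open Scope fset_scope.

Inductive form : Type :=
  | Var of nat
  | Bot
  | Imp of form & form
  | Box of form.

(* {fset form} requires a choiceType, obtained by encoding into GenTree.tree. *)
Fixpoint form_encode (f : form) : GenTree.tree nat :=
  match f with
  | Var n => GenTree.Leaf n
  | Bot => GenTree.Node 0 [::]
  | Imp f g => GenTree.Node 1 [:: form_encode f; form_encode g]
  | Box f => GenTree.Node 2 [:: form_encode f]
  end.

Fixpoint form_decode (t : GenTree.tree nat) : option form :=
  match t with
  | GenTree.Leaf n => Some (Var n)
  | GenTree.Node 0 [::] => Some Bot
  | GenTree.Node 1 [:: t; u] =>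
      if form_decode t is Some f then
        if form_decode u is Some g then Some (Imp f g) else None
      else None
  | GenTree.Node 2 [:: t] => omap Box (form_decode t)
  | _ => None
  end.

Lemma form_encodeK : pcancel form_encode form_decode.
Proof. by elim=> //= [f -> g ->|f ->]. Qed.

HB.instance Definition _ := Countable.copy form (pcan_type form_encodeK).

Definition Neg (f : form) : form := Imp f Bot.
Definition Top : form := Neg Bot.
Definition Or (f g : form) : form := Imp (Neg f) g.
Definition And (f g : form) : form := Neg (Imp f (Neg g)).

(* No unit is appended to a nonempty list: the conjunction of [:: f] is f. *)
Fixpoint seqAnd (s : seq form) : form :=
  match s with
  | [::] => Top
  | [:: f] => f
  | f :: s' => And f (seqAnd s')
  end.

Fixpoint seqOr (s : seq form) : form :=
  match s with
  | [::] => Bot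
  | [:: f] => f
  | f :: s' => Or f (seqOr s')
  end.

(* As a formula, the conjunction or disjunction of a finite set depends on an
   ordering of its elements; we take finmap's canonical enumeration. *)
Definition bigAnd (G : {fset form}) : form := seqAnd (enum_fset G).
Definition bigOr (D : {fset form}) : form := seqOr (enum_fset D).

Definition boxes (G : {fset form}) : {fset form} := [fset Box f | f in G].

Inductive arrow : Type := ArrGL | ArrS | ArrD.

(* Unions are not assumed disjoint, so the principal formula of a rule may
   also occur in its context. *)
Inductive D3seq : arrow -> {fset form} -> {fset form} -> Prop :=
  | D3seq_id (a : arrow) (f : form) :
      D3seq a [fset f] [fset f]
  | D3seq_bot (a : arrow) :
      D3seq a [fset Bot] fset0
  | D3seq_weak (a : arrow) (G D G' D' : {fset form}) :
      G `<=` G' -> D `<=` D' -> D3seq a G D -> D3seq a G' D'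
  | D3seq_impL (a : arrow) (G D : {fset form}) (f g : form) :
      D3seq a G (D `|` [fset f]) -> D3seq a ([fset g] `|` G) D ->
      D3seq a ([fset Imp f g] `|` G) D
  | D3seq_impR (a : arrow) (G D : {fset form}) (f g : form) :
      D3seq a ([fset f] `|` G) (D `|` [fset g]) ->
      D3seq a G (D `|` [fset Imp f g])
  | D3seq_cut (a : arrow) (G D P S : {fset form}) (f : form) :
      D3seq a G (D `|` [fset f]) -> D3seq a ([fset f] `|` P) S ->
      D3seq a (G `|` P) (D `|` S)
  | D3seq_GLbox (G : {fset form}) (f : form) :
      D3seq ArrGL (G `|` boxes G `|` [fset Box f]) [fset f] ->
      D3seq ArrGL (boxes G) [fset Box f]
  | D3seq_GLtoS (G D : {fset form}) :
      D3seq ArrGL G D -> D3seq ArrS G D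
  | D3seq_SboxL (G D : {fset form}) (f : form) :
      D3seq ArrS ([fset f] `|` G) D -> D3seq ArrS ([fset Box f] `|` G) D
  | D3seq_StoD (G D : {fset form}) :
      D3seq ArrS (boxes G) (boxes D) -> D3seq ArrD (boxes G) (boxes D).

(* v gives the values of the variables, and w f that of Box f: boxed formulas
   are treated as atoms, so the tautologies are exactly the substitution
   instances of classical propositional tautologies. *)
Fixpoint eval (v : nat -> bool) (w : form -> bool) (f : form) : bool :=
  match f with
  | Var n => v n
  | Bot => false
  | Imp f g => eval v w f ==> eval v w g
  | Box f => w f
  end.

Definition tautology (f : form) : Prop :=
  forall (v : nat -> bool) (w : form -> bool), eval v w f.

Inductive GL_H : form -> Prop :=
  | GL_H_taut (f : form) : tautology f -> GL_H f
  | GL_H_K (f g : form) :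
      GL_H (Imp (Box (Imp f g)) (Imp (Box f) (Box g)))
  | GL_H_Lob (f : form) : GL_H (Imp (Box (Imp (Box f) f)) (Box f))
  | GL_H_mp (f g : form) : GL_H (Imp f g) -> GL_H f -> GL_H g
  | GL_H_nec (f : form) : GL_H f -> GL_H (Box f).

Inductive S_H : form -> Prop :=
  | S_H_GL (f : form) : GL_H f -> S_H f
  | S_H_refl (f : form) : S_H (Imp (Box f) f)
  | S_H_mp (f g : form) : S_H (Imp f g) -> S_H f -> S_H g.

Inductive D3_H : form -> Prop :=
  | D3_H_taut (f : form) : tautology f -> D3_H f
  | D3_H_S (G D : {fset form}) :
      S_H (Imp (bigAnd (boxes G)) (bigOr (boxes D))) ->
      D3_H (Imp (bigAnd (boxes G)) (bigOr (boxes D)))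
  | D3_H_mp (f g : form) : D3_H (Imp f g) -> D3_H f -> D3_H g.

(* Main.v *)
(** Both directions go through one statement for all three arrows: the sequents
    derivable with an arrow are those whose formula [/\G -> \/D] is a theorem of
    the Hilbert system of that arrow. Derivability is closed under classical
    consequence (propositional LK is complete), and with cut a sequent and its
    formula are interderivable, so only the modal rules and axioms need an
    argument. The GL box rule is simulated by Loeb's axiom together with
    transitivity [Box f -> Box (Box f)], itself a consequence of Loeb's axiom. *)
Require Import Defs.
From mathcomp Require Import all_boot finmap.

Set Implicit Arguments.
Unset Strict Implicit.
Unset Printing Implicit Defensive.

Local Open Scope fset_scope.

Definition hilbert (a : arrow) : form -> Prop :=
  match a with ArrGL => GL_H | ArrS => S_H | ArrD => D3_H end.

Definition valid (s t : seq form) : Prop :=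
  forall v w, all (eval v w) s -> has (eval v w) t.

(** * Truth values of finite conjunctions and disjunctions *)

Section Evaluation.

Variables (v : nat -> bool) (w : form -> bool).
Implicit Types (G D : {fset form}) (s : seq form).

Lemma eval_seqAnd s : eval v w (seqAnd s) = all (eval v w) s.
Proof.
elim: s => //= f [|g s] /=; first by rewrite andbT.
by move=> ->; case: (eval v w f); case: (_ && _).
Qed.

Lemma eval_seqOr s : eval v w (seqOr s) = has (eval v w) s.
Proof.
elim: s => //= f [|g s] /=; first by rewrite orbF.
by move=> ->; case: (eval v w f).
Qed.

Lemma eval_bigAnd G : eval v w (bigAnd G) = all (eval v w) G.
Proof. exact: eval_seqAnd. Qed.

Lemma eval_bigOr D : eval v w (bigOr D) = has (eval v w) D.
Proof. exact: eval_seqOr. Qed.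

Lemma all_fsetU (p : pred form) G D : all p (G `|` D) = all p G && all p D.
Proof.
rewrite -all_cat; apply: eq_all_r => f.
by rewrite mem_cat in_fsetU.
Qed.

Lemma has_fsetU (p : pred form) G D : has p (G `|` D) = has p G || has p D.
Proof.
rewrite -has_cat; apply: eq_has_r => f.
by rewrite mem_cat in_fsetU.
Qed.

Lemma all_fset1 (p : pred form) f : all p [fset f] = p f.
Proof. by rewrite (@eq_all_r _ _ [:: f]) /= ?andbT // => g; rewrite !inE. Qed.

Lemma has_fset1 (p : pred form) f : has p [fset f] = p f.
Proof. by rewrite (@eq_has_r _ _ [:: f]) /= ?orbF // => g; rewrite !inE. Qed.

Definition eval_fsetE :=
  (eval_bigAnd, eval_bigOr, all_fsetU, has_fsetU, all_fset1, has_fset1).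

End Evaluation.

(** * From sequents to Hilbert proofs *)

Section Hilbert.

Implicit Types (a : arrow) (c f g h : form).

Lemma hilbert_taut a f : tautology f -> hilbert a f.
Proof.
case: a => /= ft; [exact: GL_H_taut | | exact: D3_H_taut].
exact/S_H_GL/GL_H_taut.
Qed.

Lemma hilbert_mp a f g : hilbert a (Imp f g) -> hilbert a f -> hilbert a g.
Proof. by case: a; [apply: GL_H_mp | apply: S_H_mp | apply: D3_H_mp]. Qed.

(** All three systems prove the tautologies and have modus ponens, so propositional reasoning in any
    of them reduces to a truth table. *)
Lemma hilbert_conseq a f g :
  (forall v w, eval v w f -> eval v w g) -> hilbert a f -> hilbert a g.
Proof.
move=> fg; apply/hilbert_mp/hilbert_taut => v w /=.
exact/implyP/fg.
Qed.

Lemma hilbert_conseq2 a f g h :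
  (forall v w, eval v w f -> eval v w g -> eval v w h) ->
  hilbert a f -> hilbert a g -> hilbert a h.
Proof.
move=> fgh af; apply: hilbert_mp; apply: hilbert_conseq af => v w vf /=.
exact/implyP/fgh.
Qed.

Lemma hilbert_trans a f g h :
  hilbert a (Imp f g) -> hilbert a (Imp g h) -> hilbert a (Imp f h).
Proof. by apply: hilbert_conseq2 => v w /=; do 3!case: (eval v w _). Qed.

Lemma GL_H_box_imp f g : GL_H (Imp f g) -> GL_H (Imp (Box f) (Box g)).
Proof. by move=> fg; apply: GL_H_mp (GL_H_K f g) (GL_H_nec fg). Qed.

(* Loeb's axiom for [Box f /\ f], since [f] implies
   [Box (Box f /\ f) -> Box f /\ f]. *)
Lemma GL_H_trans f : GL_H (Imp (Box f) (Box (Box f))).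
Proof.
pose h := And (Box f) f.
have hf : GL_H (Imp (Box h) (Box f)).
  apply/GL_H_box_imp/GL_H_taut => v w /=.
  by case: (w f); case: (eval v w f).
have hbf : GL_H (Imp (Box h) (Box (Box f))).
  apply/GL_H_box_imp/GL_H_taut => v w /=.
  by case: (w f); case: (eval v w f).
have fh : GL_H (Imp f (Imp (Box h) h)).
  apply: (@hilbert_conseq ArrGL) hf => v w /=.
  by case: (w h); case: (w f); case: (eval v w f).
apply: (@hilbert_trans ArrGL) (hbf).
exact: (@hilbert_trans ArrGL) (GL_H_box_imp fh) (GL_H_Lob h).
Qed.

(** By necessitation and [GL_H_K], boxes of the conjuncts combine into the box of the conjunction,
    one conjunct at a time. *)
Lemma GL_H_box_seqAnd c (s : seq form) :
  {in s, forall f, GL_H (Imp c (Box f))} -> GL_H (Imp c (Box (seqAnd s))).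
Proof.
elim: s => [_|f s IHs cs].
  apply: (@hilbert_conseq ArrGL) (GL_H_nec (GL_H_taut (f := Top) _)) => //.
  by move=> v w /= ->; rewrite implybT.
have cf : GL_H (Imp c (Box f)) by apply: cs; rewrite mem_head.
have {IHs} : GL_H (Imp c (Box (seqAnd s))).
  by apply: IHs => g gs; apply: cs; rewrite in_cons gs orbT.
(* For a one-element list [seqAnd] is the element itself, and [cf] already closes the goal. *)
case: s {cs} => [//|g s] cgs.
set h := seqAnd (g :: s) in cgs *; change (GL_H (Imp c (Box (And f h)))).
have fh : GL_H (Imp f (Imp h (And f h))).
  by apply: GL_H_taut => v w /=; do 2!case: (eval v w _).
have /(@hilbert_trans ArrGL) := GL_H_box_imp fh.
move=> /(_ _ (GL_H_K _ _)) /(@hilbert_trans ArrGL _ _ _ cf).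
apply: (@hilbert_conseq2 ArrGL) cgs => v w /=.
by case: (eval v w c) => //= ->.
Qed.

Lemma D3seq_sound a (G D : {fset form}) :
  D3seq a G D -> hilbert a (Imp (bigAnd G) (bigOr D)).
Proof.
elim=> {a G D}.
- by move=> a f; apply: hilbert_taut => v w /=; rewrite !eval_fsetE implybb.
- by move=> a; apply: hilbert_taut => v w /=; rewrite !eval_fsetE.
- move=> a G D G' D' /fsubsetP GG' /fsubsetP DD' _.
  apply: hilbert_conseq => v w /=; rewrite !eval_fsetE => /implyP GD.
  apply/implyP => /allP vG'.
  have /GD/hasP[f fD vf] : all (eval v w) G by apply/allP => f /GG'/vG'.
  by apply/hasP; exists f => //; apply: DD'.
- move=> a G D f g _ + _; apply: hilbert_conseq2 => v w /=.
  rewrite !eval_fsetE /=.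
  by case: (eval v w f); case: (eval v w g); case: (all _ _); case: (has _ _).
- move=> a G D f g _; apply: hilbert_conseq => v w /=.
  rewrite !eval_fsetE /=.
  by case: (eval v w f); case: (eval v w g); case: (all _ _); case: (has _ _).
- move=> a G D P S f _ + _; apply: hilbert_conseq2 => v w /=.
  rewrite !eval_fsetE /=.
  by case: (eval v w f); case: (all _ G); case: (all _ P);
    case: (has _ D); case: (has _ S).
- move=> G f _ /= Gf.
  (* [c] yields the box of each member of [G], and by transitivity of each member of [boxes G],
     hence [Box h]. The premise says that [h] implies [Imp (Box f) f]; boxing this implication and
     applying Loeb's axiom gives [Box f]. *)
  set c := bigAnd (boxes G); pose h := bigAnd (G `|` boxes G).
  have cG g : g \in G -> GL_H (Imp c (Box g)).
    move=> gG; apply: GL_H_taut => v w /=; rewrite eval_bigAnd.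
    by apply/implyP => /allP/(_ (Box g)); apply; apply: in_imfset.
  have ch : GL_H (Imp c (Box h)).
    apply: GL_H_box_seqAnd => g; rewrite in_fsetU => /orP[/cG //|].
    case/imfsetP=> /= k kG ->.
    exact: (@hilbert_trans ArrGL) (cG _ kG) (GL_H_trans k).
  have hf : GL_H (Imp h (Imp (Box f) f)).
    apply: (@hilbert_conseq ArrGL) Gf => v w /=; rewrite !eval_fsetE /=.
    by do 2!case: (all _ _); case: (w f).
  have cf : GL_H (Imp c (Box f)).
    apply: (@hilbert_trans ArrGL) (GL_H_Lob f).
    exact: (@hilbert_trans ArrGL) ch (GL_H_box_imp hf).
  by apply: (@hilbert_conseq ArrGL) cf => v w /=; rewrite !eval_fsetE.
- by move=> G D _; apply: S_H_GL.
- move=> G D f _; apply: (@hilbert_conseq2 ArrS) (S_H_refl f) => v w /=.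
  by rewrite !eval_fsetE /=; case: (w f); case: (eval v w f).
(* The induction hypothesis for the S-premise is exactly the side condition of the axiom scheme. *)
- by move=> G D _; apply: D3_H_S.
Qed.

End Hilbert.

(** * Propositional completeness of the sequent calculi *)

Section Sequents.

Variable a : arrow.
Implicit Types (f g : form) (s t : seq form) (G D P S : {fset form}).

(** Lists allow recursion on the two sides, while passing to sets keeps exchange and contraction
    implicit. *)
Definition lderiv s t := D3seq a [fset f in s] [fset f in t].

Lemma lderiv_weak s t s' t' :
  {subset s <= s'} -> {subset t <= t'} -> lderiv s t -> lderiv s' t'.
Proof.
by move=> ss tt; apply: D3seq_weak; apply/fsubsetP => f; rewrite !inE;
  [apply: ss | apply: tt].
Qed.

Lemma fset_cons f s : [fset g in f :: s] = f |` [fset g in s].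
Proof. by apply/fsetP => g; rewrite !inE. Qed.

Lemma fset_nil : [fset g in [::]] = fset0 :> {fset form}.
Proof. by apply/fsetP => g; rewrite !inE. Qed.

Lemma fset_seq1 f : [fset g in [:: f]] = [fset f].
Proof. by rewrite fset_cons fset_nil fsetU0. Qed.

Lemma lderiv_fset G D : lderiv G D = D3seq a G D.
Proof. by congr D3seq; apply/fsetP => f; rewrite !inE. Qed.

Lemma lderiv_impL f g s t :
  lderiv s (f :: t) -> lderiv (g :: s) t -> lderiv (Imp f g :: s) t.
Proof. by rewrite /lderiv !fset_cons fsetUC; apply: D3seq_impL. Qed.

Lemma lderiv_impR f g s t :
  lderiv (f :: s) (g :: t) -> lderiv s (Imp f g :: t).
Proof.
by rewrite /lderiv !fset_cons ![_ |` [fset _ in t]]fsetUC; apply: D3seq_impR.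
Qed.

Lemma lderiv_cut f s t : lderiv s (f :: t) -> lderiv (f :: s) t -> lderiv s t.
Proof.
rewrite /lderiv !fset_cons fsetUC => sf /(D3seq_cut sf).
by rewrite !fsetUid.
Qed.

Definition atomic f := if f is Imp _ _ then false else true.

(** Atomic formulas weigh 1, not 0, so that setting one aside also decreases the total size. *)
Fixpoint imp_size f := if f is Imp g h then (imp_size g + imp_size h).+1 else 1.

Lemma imp_size_gt0 f : 0 < imp_size f.
Proof. by case: f. Qed.

(** Unless the sequent weakens an initial one, the valuation that makes exactly the atomic formulas
    in [A] true refutes it. *)
Lemma lderiv_atomic A B :
  all atomic A -> all atomic B -> valid A B -> lderiv A B.
Proof.
move=> atA atB AB.
have [BotA|BotA] := boolP (Bot \in A).
  apply: (@lderiv_weak [:: Bot] [::]) => // [f|].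
    by rewrite inE => /eqP->.
  by rewrite /lderiv fset_seq1 fset_nil; apply: D3seq_bot.
have [/hasP[f fB fA]|disjAB] := boolP (has [in A] B).
  apply: (@lderiv_weak [:: f] [:: f]) => [g|g|]; try by rewrite inE => /eqP->.
  by rewrite /lderiv fset_seq1; apply: D3seq_id.
pose v n := Var n \in A; pose w f := Box f \in A.
have evalE f : atomic f -> eval v w f = (f \in A).
  by case: f => //= _; rewrite (negbTE BotA).
have /AB/hasP[f fB] : all (eval v w) A.
  by apply/allP => f fA; rewrite evalE // (allP atA).
rewrite evalE ?(allP atB) // => fA.
by case/hasP: disjAB; exists f.
Qed.

(* [A] and [B] collect the atomic formulas met while the implications of [s]
   and [t] are decomposed. *)
Lemma lderiv_complete_rec n s t A B :
  sumn (map imp_size s) + sumn (map imp_size t) <= n ->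
  all atomic A -> all atomic B ->
  valid (s ++ A) (t ++ B) -> lderiv (s ++ A) (t ++ B).
Proof.
elim: n s t A B => [|n IHn] [|f s] t A B.
- case: t => [|g t]; last by case: g.
  by move=> _; apply: lderiv_atomic.
- by case: f.
- case: t => [|g t]; first by move=> _; apply: lderiv_atomic.
  have [atg|] := boolP (atomic g).
    move=> le_n atA atB AB.
    apply: (@lderiv_weak ([::] ++ A) (t ++ g :: B)) => // [h|].
      by rewrite !(mem_cat, inE) -orbA orbCA.
    apply: IHn => //=.
        rewrite -ltnS; apply: leq_trans le_n => /=.
        by rewrite ltn_add2l -{1}[sumn _]add0n ltn_add2r imp_size_gt0.
      by rewrite atg.
    move=> v w /AB; rewrite /= !has_cat /=; case: (eval v w g) => //= _.
    by rewrite orbT.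
  case: g => //= g h _; rewrite add0n addSn ltnS => le_n atA atB AB.
  apply: lderiv_impR; apply: (IHn [:: g] (h :: t)) => //=.
    by rewrite addn0 addnA.
  move=> v w /= /andP[vg /AB] /=; rewrite vg.
  by case: (eval v w h).
have [atf|] := boolP (atomic f).
  move=> le_n atA atB AB.
  apply: (@lderiv_weak (s ++ f :: A) (t ++ B)) => // [h|].
    by rewrite !(mem_cat, inE) -orbA orbCA.
  apply: IHn => //=.
      rewrite -ltnS; apply: leq_trans le_n => /=.
      by rewrite ltn_add2r -{1}[sumn _]add0n ltn_add2r imp_size_gt0.
    by rewrite atf.
  move=> v w; rewrite all_cat /= andbCA -all_cat; exact: AB.
case: f => //= f g _; rewrite !addSn ltnS => le_n atA atB AB.
apply: lderiv_impL.
  apply: (IHn s (f :: t)) => //=.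
    apply: leq_trans le_n; rewrite addnCA addnA leq_add2r -addnA leq_add2l.
    exact: leq_addl.
  move=> v w vsA /=; case vf: (eval v w f) => //=.
  by apply: AB; rewrite /= vf.
apply: (IHn (g :: s) t) => //=.
  by apply: leq_trans le_n; rewrite -!addnA leq_addl.
move=> v w /= /andP[vg vsA].
by apply: AB; rewrite /= vg implybT.
Qed.

Lemma lderiv_complete s t : valid s t -> lderiv s t.
Proof.
move=> st; have := @lderiv_complete_rec _ s t [::] [::] (leqnn _) isT isT.
by rewrite !cats0; apply.
Qed.

Lemma D3seq_complete G D : valid G D -> D3seq a G D.
Proof. by move=> /lderiv_complete; rewrite lderiv_fset. Qed.

(** Used to trade a sequent for its formula: the members of [s], then those of [t], are cut away one
    by one. *)
Lemma lderiv_multicut s t s' t' :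
  {in s, forall f, lderiv s' (f :: t')} ->
  {in t, forall f, lderiv (f :: s') t'} ->
  lderiv (s ++ s') (t ++ t') -> lderiv s' t'.
Proof.
elim: s => [|f s IHs] fs; last first.
  move=> ft fst; apply: IHs => //.
    by move=> g gs; apply: fs; rewrite inE gs orbT.
  apply: lderiv_cut fst; apply: lderiv_weak (fs f (mem_head _ _)) => g.
    by rewrite mem_cat orbC => ->.
  by rewrite !inE mem_cat => /orP[->//|->]; rewrite !orbT.
elim: t {fs} => [//|f t IHt] ft fst; apply: IHt.
  by move=> g gt; apply: ft; rewrite inE gt orbT.
apply: lderiv_cut fst _; apply: lderiv_weak (ft f (mem_head _ _)) => g //.
by rewrite mem_cat orbC => ->.
Qed.

(** If a member of [G] fails, the implication holds, and any member of [D] implies it; these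
    propositional sequents are cut against the given one. Conversely, the formula is cut against its
    own propositional unfolding. *)
Lemma D3seq_formula G D :
  D3seq a G D <-> D3seq a fset0 [fset Imp (bigAnd G) (bigOr D)].
Proof.
rewrite -lderiv_fset; set f := Imp _ _.
rewrite -fset_nil -fset_seq1 -/(lderiv _ _).
split=> GD.
  apply: (@lderiv_multicut G D) => [g gG|g gD|].
  - apply: lderiv_complete => v w _ /=; rewrite !eval_fsetE.
    by case: (boolP (all _ _)) => [/allP->|]; rewrite ?orbT.
  - apply: lderiv_complete => v w /=; rewrite !eval_fsetE andbT orbF => vg.
    by apply/implyP => _; apply/hasP; exists g.
  - by apply: lderiv_weak GD => g; rewrite mem_cat => ->.
apply: (@lderiv_cut f).
  by apply: lderiv_weak GD => g //; rewrite !inE => ->.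
apply: lderiv_complete => v w /= /andP[]; rewrite !eval_fsetE.
by case: (all _ _).
Qed.

End Sequents.

(** * From Hilbert proofs to sequents *)

Lemma D3seq_mp a (f g : form) :
  D3seq a fset0 [fset Imp f g] -> D3seq a fset0 [fset f] ->
  D3seq a fset0 [fset g].
Proof.
rewrite -fset_nil -!fset_seq1 => dfg df; apply: (@lderiv_cut a f).
  by apply: lderiv_weak df => h //; rewrite !inE => ->.
apply: (@lderiv_cut a (Imp f g)).
  by apply: lderiv_weak dfg => h //; rewrite !inE => ->.
by apply: lderiv_complete => v w /=; do 2!case: (eval v w _).
Qed.

(** Both modal axioms come from one use of the GL box rule whose premise is propositionally valid;
    for Loeb's axiom the diagonal formula [Box f] detaches [f] from [Imp (Box f) f]. *)
Lemma GL_H_D3seq f : GL_H f -> D3seq ArrGL fset0 [fset f].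
Proof.
elim=> {f} [f ft|f g|f|f g _ fg _ df|f _ df].
- by apply: D3seq_complete => v w _; rewrite has_fset1.
- rewrite -[[fset _]]fset0U; apply/D3seq_impR/D3seq_impR.
  rewrite fset0U fsetU0.
  have -> : [fset Box f; Box (Imp f g)] = boxes [fset f; Imp f g].
    by rewrite /boxes imfset_fset2.
  apply/D3seq_GLbox/D3seq_complete => v w.
  rewrite !all_fsetU !all_fset1 has_fset1 /=.
  by case: (eval v w f) => //= /andP[/andP[->]].
- rewrite -[[fset _]]fset0U; apply: D3seq_impR; rewrite fset0U fsetU0.
  have -> : [fset Box (Imp (Box f) f)] = boxes [fset Imp (Box f) f].
    by rewrite /boxes imfset_fset1.
  apply/D3seq_GLbox/D3seq_complete => v w.
  rewrite !all_fsetU !all_fset1 has_fset1 /=.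
  by case: (w f); rewrite ?andbF //= => /andP[/andP[->]].
- exact: D3seq_mp fg df.
(* Necessitation is the GL box rule with empty context, the diagonal formula being added by
   weakening. *)
- have box0 : boxes fset0 = fset0 by rewrite /boxes imfset0.
  rewrite -[X in D3seq _ X]box0; apply: D3seq_GLbox.
  exact: D3seq_weak df.
Qed.

Lemma S_H_D3seq f : S_H f -> D3seq ArrS fset0 [fset f].
Proof.
elim=> {f} [f /GL_H_D3seq|f|f g _ fg _ df]; first exact: D3seq_GLtoS.
  rewrite -[[fset _]]fset0U; apply/D3seq_impR/D3seq_SboxL.
  by rewrite fsetU0 fset0U; apply: D3seq_id.
exact: D3seq_mp fg df.
Qed.

Lemma D3_H_D3seq f : D3_H f -> D3seq ArrD fset0 [fset f].
Proof.
elim=> {f} [f ft|G D /S_H_D3seq GD|f g _ fg _ df]; last exact: D3seq_mp fg df.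
  by apply: D3seq_complete => v w _; rewrite has_fset1.
(* [D3seq_StoD] needs boxed sides, so the S-derivable formula is first unpacked into its sequent and
   packed again after the change of arrow. *)
apply: (D3seq_formula _ _ _).1; apply: D3seq_StoD.
exact: (D3seq_formula _ _ _).2.
Qed.

Theorem proposition6p2 (G D : {fset form}) :
  D3seq ArrD G D <-> D3_H (Imp (bigAnd G) (bigOr D)).
Proof.
split; first exact: D3seq_sound.
by move=> /D3_H_D3seq; apply: (D3seq_formula _ _ _).2.
Qed.
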